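(* For every $n>1$ and $1\le r\le n-1$, \begin{align*} N'(K(n,r))&=N(K(n,r))=M(K(n,r))=M'(K(n,r))=\left\lceil \frac{n-1}{n-r}\right\rceil,\\ N'(K'(n,r))&=N(K'(n,r))=M(K'(n,r))=M'(K'(n,r))=\left\lceil \frac{n}{n-r}\right\rceil,\\ N'(L(n,r))&=N(L(n,r))=M(L(n,r))=M'(L(n,r))=\left\lceil \frac{n}{n-r}\right\rceil. \end{align*}
   Context: $PT_n$ is the semigroup, under composition (functions act on the right), of all partial functions from $X_n=\{1,\dots,n\}$ to itself; $T_n$ is its subsemigroup of functions with domain $X_n$, and $I_n$ its subsemigroup of injective partial functions. The rank of $\alpha\in PT_n$ is the cardinality of its image. $K'(n,r)$, $K(n,r)$ and $L(n,r)$ are the semigroups of all elements of rank at most $r$ in $PT_n$, $T_n$ and $I_n$, respectively. A generating set of a finite semigroup $S$ is a non-empty subset $A\subseteq S$ such that every element of $S$ is a product of one or more elements of $A$; it is minimal if no proper subset is a generating set; $\mathrm{rank}(S)$ is the smallest cardinality of a generating set. For a generating set $A$ and $s\in S$, the length $l_A(s)$ is the least $k$ such that $s=a_1\cdots a_k$ with $a_i\in A$, except that the identity element of $S$ (if there is one) has length $0$ by convention. $\ker(S)$ is the minimum ideal of $S$ and $N(S,A)=\min\{l_A(s): s\in\ker(S)\}$. The depth parameters are: $N(S)$ and $M(S)$, respectively the minimum and the maximum of $N(S,A)$ over all generating sets $A$ with $|A|=\mathrm{rank}(S)$; $N'(S)$ and $M'(S)$, respectively the minimum and the maximum of $N(S,A)$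 over all minimal generating sets $A$. *)

(* Defs.v *)
From HB Require Import structures.
From Stdlib Require Import ClassicalEpsilon.
From mathcomp Require Import all_boot all_order all_algebra.

Set Implicit Arguments.
Unset Strict Implicit.
Unset Printing Implicit Defensive.

Import Order.TTheory GRing.Theory Num.Theory.

HB.structure Definition FinSemigroup := {T of Finite T & Semigroup T}.

(* [least P] is unspecified when [P] is empty, and [greatest P] when [P] is
   empty or unbounded; [leastP] and [greatestP] cover the other cases. *)
Definition is_least (P : nat -> Prop) (m : nat) : Prop :=
  P m /\ forall k, P k -> m <= k.
Definition is_greatest (P : nat -> Prop) (m : nat) : Prop :=
  P m /\ forall k, P k -> k <= m.
Definition least (P : nat -> Prop) : nat := epsilon (inhabits 0) (is_least P).
Definition greatest (P : nat -> Prop) : nat :=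
  epsilon (inhabits 0) (is_greatest P).

Lemma leastP (P : nat -> Prop) (k : nat) : P k -> is_least P (least P).
Proof.
move=> Pk; apply: epsilon_spec.
elim/ltn_ind: k Pk => k IHk Pk.
case: (classic (exists2 j, j < k & P j)) => [[j ltjk Pj]|noj].
  exact: (IHk j).
exists k; split=> // j Pj; rewrite leqNgt; apply/negP=> ltjk.
by apply: noj; exists j.
Qed.

Lemma greatestP (P : nat -> Prop) (k b : nat) :
  P k -> (forall j, P j -> j <= b) -> is_greatest P (greatest P).
Proof.
move=> Pk leb; apply: epsilon_spec.
pose Q d := exists2 j, P j & d = b - j.
have [|[k0 Pk0 dE] dmin] := @leastP Q (b - k); first by exists k.
exists k0; split=> // j Pj.
have := dmin (b - j) (ex_intro2 _ _ j Pj erefl).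
rewrite dE => le_d.
by rewrite -(subKn (leb _ Pj)) -(subKn (leb _ Pk0)) leq_sub2l.
Qed.

Section Depth.
Local Open Scope group_scope.
Variable T : FinSemigroup.type.
Implicit Types (S A B I J : {set T}) (s e : T).

Definition prod_of A (k : nat) s : Prop :=
  exists a w, [/\ all (mem A) (a :: w), size (a :: w) = k
                & s = foldl *%g a w].

Definition generates S A : Prop :=
  [/\ A != set0, A \subset S & forall s, s \in S -> exists k, prod_of A k s].

Definition min_generates S A : Prop :=
  generates S A /\ forall B, B \proper A -> ~ generates S B.

Definition sg_rank S : nat :=
  least (fun k => exists2 A, generates S A & #|A| = k).

Definition is_identity S e : bool :=
  (e \in S) && [forall x in S, (e * x == x) && (x * e == x)].

Definition length S A s : nat :=
  if is_identity S s then 0 else least (fun k => prod_of A k s).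

Definition ideal S I : bool :=
  [&& I != set0, I \subset S &
      [forall x in I, forall s in S, (s * x \in I) && (x * s \in I)]].

Definition min_ideal S I : bool :=
  ideal S I && [forall J, ideal S J ==> (I \subset J)].

(* The default [set0] is never used when [S] is a semigroup: see [kerP]. *)
Definition ker S : {set T} := odflt set0 [pick I | min_ideal S I].

Definition depth S A : nat :=
  least (fun k => exists2 s, s \in ker S & length S A s = k).

Definition depthN S : nat :=
  least (fun k => exists A, [/\ generates S A, #|A| = sg_rank S & depth S A = k]).
Definition depthM S : nat :=
  greatest
    (fun k => exists A, [/\ generates S A, #|A| = sg_rank S & depth S A = k]).
Definition depthN' S : nat :=
  least (fun k => exists2 A, min_generates S A & depth S A = k).
Definition depthM' S : nat :=
  greatest (fun k => exists2 A, min_generates S A & depth S A = k).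

Lemma kerP S : S != set0 -> {in S &, forall x y, x * y \in S} ->
  min_ideal S (ker S).
Proof.
move=> nzS SS; rewrite /ker; case: pickP => //= noI.
have idS : ideal S S.
  rewrite /ideal nzS subxx /=; apply/forall_inP=> x Sx.
  by apply/forall_inP=> s Ss; rewrite !SS.
have [I /minsetP[idI minI] _] :=
  @minset_exists _ (ideal S) S idS.
suff: min_ideal S I by rewrite noI.
rewrite /min_ideal idI; apply/forallP=> J; apply/implyP=> idJ.
suff idIJ : ideal S (I :&: J) by rewrite -(minI _ idIJ (subsetIl _ _)) subsetIr.
have [/set0Pn[x Ix] sIS /forall_inP aI] := and3P idI.
have [/set0Pn[y Jy] sJS /forall_inP aJ] := and3P idJ.
apply/and3P; split; first apply/set0Pn.
- exists (x * y); rewrite inE.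
  have /forall_inP/(_ y (subsetP sJS _ Jy))/andP[_ ->] := aI x Ix.
  by have /forall_inP/(_ x (subsetP sIS _ Ix))/andP[-> _] := aJ y Jy.
- exact: subset_trans (subsetIl _ _) sIS.
apply/forall_inP=> z /setIP[Iz Jz]; apply/forall_inP=> s Ss; rewrite !inE.
have /forall_inP/(_ s Ss)/andP[-> ->] := aI z Iz.
by have /forall_inP/(_ s Ss)/andP[-> ->] := aJ z Jz.
Qed.

End Depth.

(* 'I_n plays the role of {1, ..., n}; [f x = None] means that [x] is not in
   the domain of [f]. *)
Definition PT (n : nat) : Type := {ffun 'I_n -> option 'I_n}.
HB.instance Definition _ n := Finite.on (PT n).

(* Functions act on the right: [pcomp f g] applies [f] first. *)
Definition pcomp (n : nat) (f g : PT n) : PT n := [ffun x => obind g (f x)].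

Lemma pcompA (n : nat) : associative (@pcomp n).
Proof.
move=> f g h; apply/ffunP=> x; rewrite !ffunE.
by case: (f x) => //= y; rewrite ffunE.
Qed.

HB.instance Definition _ n := hasMul.Build (PT n) (@pcomp n).
HB.instance Definition _ n := Magma_isSemigroup.Build (PT n) (@pcompA n).

Section Transformations.
Variable n : nat.

Definition pimage (f : PT n) : {set 'I_n} :=
  [set y | [exists x, f x == Some y]].
Definition prank (f : PT n) : nat := #|pimage f|.
Definition pdom (f : PT n) : {set 'I_n} := [set x | f x != None].

Definition full_trans : {set PT n} := [set f | pdom f == setT].
Definition partial_inj : {set PT n} :=
  [set f : PT n |
     [forall x in pdom f, forall y in pdom f, (f x == f y) ==> (x == y)]].

Variable r : nat.
Definition K' : {set PT n} := [set f | prank f <= r].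
Definition K : {set PT n} := [set f in full_trans | prank f <= r].
Definition L : {set PT n} := [set f in partial_inj | prank f <= r].
End Transformations.

Arguments K' n r : clear implicits.
Arguments K n r : clear implicits.
Arguments L n r : clear implicits.

(* Main.v *)
Require Import Defs.
From mathcomp Require Import all_boot all_order all_algebra.
From mathcomp Require Import zify.

(** Let [S] be one of the three semigroups and [m] the rank of the elements of
its minimum ideal: [m = 1] for total maps, where the ideal consists of the
constants, and [m = 0] for partial or partial injective maps, where it is the
empty map. Every minimal generating set [A] of [S] is shown to have the same
depth, namely the least [k] with [n - m <= k * (n - r)]. A generating set of
least cardinality is minimal, so the four parameters coincide.

An element of rank less than [r] is a product of two elements of rank one more
([split_rank]; this is where [r < n] enters), and a product of rank [r] has only
factors of rank [r]. Hence the elements of rank [r] in [A] already generate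
[S], and by minimality there are no others ([min_generates_top]).

Lower bound: if [f] and [g] have rank at least [n - a] and [n - b], then [f * g]
has rank at least [n - (a + b)], because [g] loses at most [b] points on any
subset. A product of [k] elements of rank [r] thus has rank at least
[n - k * (n - r)] ([long_product]).

Upper bound: a product is built greedily. If [f = a * u] and [a] both have rank
[r], then [u] is injective on the image of [a], so [a] and [f] have the same
kernel. Since [A] generates [S], every kernel of an element of rank [r] is
therefore the kernel of some element of [A]. Now for every set [Y] some element
of rank [r] sends [Y] to at most [max (m, #|Y| - (n - r))] points: all of its
[n - r] defects can be spent inside [Y] until only [m] points are left. Taking
for [Y] the image of the product built so far, each new factor from [A] lowers
the rank by at least [n - r] until it reaches [m] ([short_product]). *)

Set Implicit Arguments.
Unset Strict Implicit.
Unset Printing Implicit Defensive.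

(** * Depth parameters of a finite semigroup *)

Lemma least_eq (P : nat -> Prop) m : is_least P m -> least P = m.
Proof.
move=> [Pm minm]; have [Pl minl] := leastP Pm.
by apply/eqP; rewrite eqn_leq minl // minm.
Qed.

Lemma greatest_eq (P : nat -> Prop) m : is_greatest P m -> greatest P = m.
Proof.
move=> [Pm maxm]; have [Pl maxl] := greatestP Pm maxm.
by apply/eqP; rewrite eqn_leq maxm // maxl.
Qed.

Section Semigroups.
Local Open Scope group_scope.
Variable T : FinSemigroup.type.
Implicit Types (S A B : {set T}) (s u : T).

Lemma foldl_mulg a b (w : seq T) :
  foldl *%g (a * b) w = a * foldl *%g b w.
Proof. by elim: w a b => //= c w IHw a b; rewrite -mulgA !IHw. Qed.

Lemma prod_of1 A a : a \in A -> prod_of A 1 a.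
Proof. by move=> Aa; exists a, [::]; rewrite /= Aa. Qed.

Lemma prod_ofM A j k s u :
  prod_of A j s -> prod_of A k u -> prod_of A (j + k) (s * u).
Proof.
move=> [a [v [Av <- ->]]] [b [w [Bw <- ->]]]; exists a, (v ++ b :: w); split.
- by rewrite -cat_cons all_cat Av.
- by rewrite -cat_cons size_cat.
- by rewrite foldl_cat /= foldl_mulg.
Qed.

Lemma prod_of_left A k s : prod_of A k s ->
  exists2 a, a \in A & s = a \/ exists u, s = a * u.
Proof.
move=> [a [w [/= /andP[Aa _] _ ->]]]; exists a => //.
case: w => [|b w] /=; first by left.
by right; exists (foldl *%g b w); rewrite foldl_mulg.
Qed.

(** Induction on words from the left, which fits the bound
[prank f + prank g <= prank (f * g) + n] with [f] a generator. *)
Lemma prod_of_ind A (P : nat -> T -> Prop) :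
    (forall a, a \in A -> P 1%N a) ->
    (forall a k s, a \in A -> prod_of A k s -> P k s -> P k.+1 (a * s)) ->
  forall k s, prod_of A k s -> P k s.
Proof.
move=> P1 PM k s [a [w [Aw <- ->]]] {k s}.
elim: w a Aw => [|b w IHw] a /= /andP[Aa Aw]; first exact: P1.
rewrite foldl_mulg; apply: (PM) => //; last exact: IHw.
by exists b, w; split.
Qed.

Lemma generates_self S : S != set0 -> generates S S.
Proof. by move=> nzS; split=> // s Ss; exists 1%N; apply: prod_of1. Qed.

Lemma sg_rankP S A : generates S A ->
  is_least (fun k => exists2 B, generates S B & #|B| = k) (sg_rank S).
Proof. by move=> gA; apply: (@leastP _ #|A|); exists A. Qed.

(** A proper subset that generates would have fewer than [sg_rank S] elements. *)
Lemma rank_min_generates S A :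
  generates S A -> #|A| = sg_rank S -> min_generates S A.
Proof.
move=> gA cA; split=> // B /proper_card ltBA gB.
have [_ minr] := sg_rankP gA.
by have := minr #|B|; rewrite -cA leqNgt ltBA => /(_ (ex_intro2 _ _ B gB erefl)).
Qed.

(** The side condition on identities keeps the convention that the identity
has length 0 from interfering. *)
Lemma depth_eq S A d :
    (forall s, s \in ker S -> ~~ is_identity S s) ->
    (forall s, s \in ker S -> exists k, prod_of A k s) ->
    (exists2 s, s \in ker S & prod_of A d s) ->
    (forall s k, s \in ker S -> prod_of A k s -> (d <= k)%N) ->
  depth S A = d.
Proof.
move=> nid gA [s0 ks0 Ps0] lb; apply: least_eq.
have lenE s : s \in ker S -> length S A s = least (fun k => prod_of A k s).
  by move=> /nid/negPf; rewrite /length => ->.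
split=> [|k [s ks <-]].
  exists s0 => //; rewrite lenE //; apply: least_eq; split=> // k; exact: lb.
rewrite lenE //; have [k0 Pk0] := gA _ ks.
by have [Pl _] := @leastP (fun k => prod_of A k s) k0 Pk0; apply: lb ks Pl.
Qed.

(** The sets over which the four parameters take a minimum or a maximum are all
equal to [[set d]]: generating sets of least cardinality are minimal, and they
exist because [S] generates itself. *)
Lemma depths_const S d : S != set0 ->
    (forall A, min_generates S A -> depth S A = d) ->
  [/\ depthN' S = d, depthN S = d, depthM S = d & depthM' S = d].
Proof.
move=> nzS dE; have [[A gA cA] _] := sg_rankP (generates_self nzS).
have mA := rank_min_generates gA cA.
split; [apply: least_eq|apply: least_eq|apply: greatest_eq|apply: greatest_eq].
- by split=> [|k [B /dE-> ->] //]; exists A => //; apply: dE.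
- split=> [|k [B [gB cB]]]; first by exists A; split=> //; apply: dE.
  by rewrite (dE _ (rank_min_generates gB cB)) => ->.
- split=> [|k [B [gB cB]]]; first by exists A; split=> //; apply: dE.
  by rewrite (dE _ (rank_min_generates gB cB)) => ->.
- by split=> [|k [B /dE-> ->] //]; exists A => //; apply: dE.
Qed.

End Semigroups.

(** * Images and ranks of partial maps *)

Section PartialMaps.
Local Open Scope group_scope.
Variable n : nat.
Implicit Types (f g h : PT n) (Y Z W : {set 'I_n}) (A C : {set PT n}).

Lemma mulPTE f g x : (f * g) x = obind g (f x).
Proof. by rewrite ffunE. Qed.

Definition pimg f Y : {set 'I_n} := [set y | [exists x in Y, f x == Some y]].

Lemma pimgP f Y y :
  reflect (exists2 x, x \in Y & f x = Some y) (y \in pimg f Y).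
Proof.
rewrite inE; apply: (iffP exists_inP) => -[x Yx].
  by move/eqP; exists x.
by move=> fx; exists x => //; apply/eqP.
Qed.

Lemma pimageP f y : reflect (exists x, f x = Some y) (y \in pimage f).
Proof.
rewrite inE; apply: (iffP existsP) => -[x]; first by move/eqP; exists x.
by move=> fx; exists x; apply/eqP.
Qed.

Lemma pimg_setT f : pimg f setT = pimage f.
Proof.
apply/setP=> y; apply/pimgP/pimageP=> [[x _ fx]|[x fx]]; by exists x.
Qed.

Lemma pimgM f g Y : pimg (f * g) Y = pimg g (pimg f Y).
Proof.
apply/setP=> z; apply/pimgP/pimgP=> [[x Yx]|[y /pimgP[x Yx fx] gy]].
  rewrite mulPTE; case fx: (f x) => [y|] //= gy.
  by exists y => //; apply/pimgP; exists x.
by exists x => //; rewrite mulPTE fx.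
Qed.

Lemma pimageM f g : pimage (f * g) = pimg g (pimage f).
Proof. by rewrite -!pimg_setT pimgM. Qed.

Lemma pimgU f Y Z : pimg f (Y :|: Z) = pimg f Y :|: pimg f Z.
Proof.
apply/setP=> y; rewrite in_setU; apply/pimgP/orP.
  by move=> [x /setUP[]] Yx fx; [left|right]; apply/pimgP; exists x.
by move=> [] /pimgP[x Yx fx]; exists x; rewrite // inE Yx ?orbT.
Qed.

Lemma card_pimg f Y : #|pimg f Y| <= #|Y|.
Proof.
apply: leq_trans (leq_imset_card (fun x => odflt x (f x)) Y).
apply/subset_leq_card/subsetP=> y /pimgP[x Yx fx].
by apply/imsetP; exists x; rewrite ?fx.
Qed.

(** Enlarging [W] to [Z] adds at most [#|Z| - #|W|] points to the image. This one
inequality gives both the bound on the rank of a product, with [Z] the whole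
set, and the comparison of kernels in [card_pimg_head]. *)
Lemma card_pimg_sub f W Z : W \subset Z ->
  #|pimg f Z| + #|W| <= #|pimg f W| + #|Z|.
Proof.
move=> sWZ; have := cardsID W Z; rewrite (setIidPr sWZ).
have := card_pimg f (Z :\: W).
have := cardsU (pimg f W) (pimg f (Z :\: W)).
rewrite -pimgU.
have -> : W :|: Z :\: W = Z.
  apply/setP=> x; rewrite !inE; case Wx: (x \in W) => //=.
  by rewrite (subsetP sWZ).
lia.
Qed.

Lemma prankM_geq f g : prank f + prank g <= prank (f * g) + n.
Proof.
have := card_pimg_sub g (subsetT (pimage f)).
by rewrite pimg_setT -pimageM cardsT card_ord addnC.
Qed.

Lemma prankM_leql f g : prank (f * g) <= prank f.
Proof. by rewrite /prank pimageM card_pimg. Qed.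

Lemma prankM_leqr f g : prank (f * g) <= prank g.
Proof.
rewrite /prank pimageM; apply/subset_leq_card/subsetP=> y /pimgP[x _ gx].
by apply/pimageP; exists x.
Qed.

(** If [a * u] has the rank of [a], then [u] is injective on the image of [a], so
[a] collapses every set exactly as [a * u] does. *)
Lemma card_pimg_head a u Y : prank a <= prank (a * u) ->
  #|pimg a Y| <= #|pimg (a * u) Y|.
Proof.
have sY : pimg a Y \subset pimage a.
  by apply/subsetP=> y /pimgP[x _ ax]; apply/pimageP; exists x.
have := card_pimg_sub u sY; rewrite -pimageM -pimgM /prank; lia.
Qed.

(** * Depth of a semigroup of maps of bounded rank *)

Definition rank_le C r : {set PT n} := [set f in C | prank f <= r].

(** The common features of the three families that determine the depth of
[rank_le C r]. Here [m] is the rank of the elements of the minimum ideal, and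
[collapsing_absorb] says that the maps of rank at most [m] are right zeros,
which puts all of them in that ideal. *)
Record collapsing C (r m : nat) : Prop := Collapsing {
  collapsing_mul : {in C &, forall f g, f * g \in C};
  collapsing_split : forall f, f \in C -> (prank f).+2 <= n ->
    exists e h, [/\ e \in C, h \in C, prank e = (prank f).+1,
                    prank h = (prank f).+1 & f = e * h];
  collapsing_img : forall Y, exists f,
    [/\ f \in C, prank f = r & #|pimg f Y| <= maxn m (#|Y| - (n - r))];
  collapsing_absorb : {in C &, forall f c, prank c <= m -> f * c = c};
  collapsing_nontriv : exists f g,
    [/\ f \in rank_le C r, g \in rank_le C r & f != g]
}.

Section Collapsing.
Variables (C : {set PT n}) (r m : nat).
Hypotheses (famC : collapsing C r m) (ltrn : r < n) (ltmn : m < n).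
Let S := rank_le C r.

Lemma rank_leM : {in S &, forall f g, f * g \in S}.
Proof.
move=> f g /setIdP[Cf rf] /setIdP[Cg rg]; rewrite inE.
by rewrite (collapsing_mul famC) // (leq_trans (prankM_leql _ _)).
Qed.

Lemma rank_le_neq0 : S != set0.
Proof.
have [f [_ [Sf _ _]]] := collapsing_nontriv famC.
by apply/set0Pn; exists f.
Qed.

Lemma prod_of_rank_le A k s : A \subset S -> prod_of A k s -> s \in S.
Proof.
move=> sAS; apply: (@prod_of_ind _ A (fun _ s => s \in S)).
  by move=> a /(subsetP sAS).
by move=> a {}k {}s /(subsetP sAS) Sa _ Ss; apply: rank_leM.
Qed.

(** No factor has smaller rank than the product, so a product of rank [r] only
involves generators of rank [r]. *)
Lemma prod_of_top A k s : A \subset S -> prod_of A k s -> r <= prank s ->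
  prod_of [set a in A | prank a == r] k s.
Proof.
move=> sAS; move: k s.
apply: (@prod_of_ind _ A (fun k s => r <= prank s -> prod_of _ k s)).
  move=> a Aa ra; apply: prod_of1; rewrite inE Aa eqn_leq ra andbT /=.
  by have:= subsetP sAS _ Aa; rewrite inE => /andP[].
move=> a k s Aa _ IH rs; rewrite -add1n; apply: prod_ofM; last first.
  by apply: IH; apply: leq_trans rs (prankM_leqr _ _).
apply: prod_of1; rewrite inE Aa eqn_leq (leq_trans rs (prankM_leql _ _)) andbT.
by have:= subsetP sAS _ Aa; rewrite inE => /andP[].
Qed.

(** The elements of rank [r] of a generating set generate everything: those of
rank [r] by [prod_of_top], the others by repeated use of [collapsing_split].
Minimality then excludes generators of smaller rank. *)
Lemma min_generates_top A a : min_generates S A -> a \in A -> prank a = r.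
Proof.
move=> [[nzA sAS gA] minA]; set B := [set a in A | prank a == r].
suff gB : generates S B.
  have: ~~ (B \proper A) by apply/negP=> /minA.
  have sBA : B \subset A by apply/subsetP=> b; rewrite inE => /andP[].
  rewrite properEneq sBA andbT negbK => /eqP<-.
  by rewrite inE => /andP[_ /eqP].
have genB s : s \in S -> exists k, prod_of B k s.
  have [d] := ubnP (r - prank s); elim: d s => // d IHd s lt_d Ss.
  have [ltsr|lers] := ltnP (prank s) r; last first.
    by have [k] := gA s Ss; exists k; apply: prod_of_top.
  have [Cs _] := setIdP Ss.
  have [|e [h [Ce Ch re rh ->]]] := collapsing_split famC Cs; first by lia.
  have [||j Pj] := IHd e; [by lia | by rewrite inE Ce re|].
  have [||k Pk] := IHd h; [by lia | by rewrite inE Ch rh|].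
  by exists (j + k); apply: prod_ofM.
split=> //; last first.
  by apply: subset_trans sAS; apply/subsetP=> b; rewrite inE => /andP[].
have [f [Cf rf _]] := collapsing_img famC set0.
have [|k /prod_of_left[b Bb _]] := genB f; first by rewrite inE Cf rf leqnn.
by apply/set0Pn; exists b.
Qed.

(** The first letter of a word for [f] collapses [Y] as much as [f] does when [f]
has rank [r], so a map of [S] that collapses [Y] optimally can be replaced by a
generator. *)
Lemma generator_collapse A Y : generates S A ->
  exists2 a, a \in A & #|pimg a Y| <= maxn m (#|Y| - (n - r)).
Proof.
move=> [_ sAS gA]; have [f [Cf rf fY]] := collapsing_img famC Y.
have [|k /prod_of_left[a Aa fE]] := gA f; first by rewrite inE Cf rf leqnn.
exists a => //; apply: leq_trans fY; case: fE => [->//|[u fE]].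
have [_ ra] := setIdP (subsetP sAS _ Aa).
by rewrite fE; apply: card_pimg_head; rewrite -fE rf.
Qed.

(** Greedy choice: the next generator is one that collapses the image of the
product built so far. *)
Lemma short_product A k : generates S A ->
  exists2 s, prod_of A k.+1 s & prank s <= maxn m (n - k.+1 * (n - r)).
Proof.
move=> gA; elim: k => [|k [s Ps rs]].
  have [a Aa] := generator_collapse setT gA.
  rewrite pimg_setT cardsT card_ord mul1n.
  by exists a => //; apply: prod_of1.
have [a Aa aY] := generator_collapse (pimage s) gA.
exists (s * a); first by rewrite -addn1; apply: prod_ofM (prod_of1 _).
rewrite /prank pimageM; apply: leq_trans aY _.
by move: rs; rewrite /prank mulSn; lia.
Qed.

Lemma long_product A k s : {in A, forall a, prank a = r} -> prod_of A k s ->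
  n <= prank s + k * (n - r).
Proof.
move=> rA; move: k s.
apply: (@prod_of_ind _ A (fun k s => n <= prank s + k * (n - r))).
  by move=> a /rA->; lia.
move=> a k s /rA ra _ IHs; have := prankM_geq a s; rewrite ra mulSn.
move: (k * _)%N IHs => q; move: (prank s) => i.
(* p stands for the rank of the product, whose multiplication is displayed
   through two different but convertible semigroup structures. *)
have: forall p, r + i <= p + n -> n <= i + q -> n <= p + (n - r + q) by lia.
by move=> arith IHs lep; apply: arith lep IHs.
Qed.

(** The maps of rank at most [m] form an ideal, which therefore contains the
minimum ideal; conversely a right zero [s] equals [x * s] for any [x] in the minimum
ideal, hence lies in it. *)
Lemma ker_rank s : (s \in ker S) = (s \in S) && (prank s <= m).
Proof.
have [/and3P[/set0Pn[x kx] sKS /forall_inP idK] /forallP minK] :=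
  andP (kerP rank_le_neq0 rank_leM).
apply/idP/andP=> [ks | [Ss rs]].
  split; first exact: subsetP ks.
  (* n + 1 factors are more than enough to reach rank m. *)
  have [s0 P0 r0] := short_product n (generates_self rank_le_neq0).
  pose J := [set f in S | prank f <= m].
  suff idJ : ideal S J.
    have /implyP/(_ idJ)/subsetP/(_ s ks) := minK J.
    by rewrite inE => /andP[].
  apply/and3P; split.
  - apply/set0Pn; exists s0; rewrite inE (prod_of_rank_le _ P0) //=.
    by apply: leq_trans r0 _; nia.
  - by apply/subsetP=> f /setIdP[].
  - apply/forall_inP=> f /setIdP[Sf rf]; apply/forall_inP=> g Sg.
    apply/andP; split; apply/setIdP; split; try exact: rank_leM.
      exact: leq_trans (prankM_leqr _ _) rf.
    exact: leq_trans (prankM_leql _ _) rf.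
have [[Cs _] [Cx _]] := (setIdP Ss, setIdP (subsetP sKS _ kx)).
rewrite -(collapsing_absorb famC Cx Cs rs).
by have /forall_inP/(_ s Ss)/andP[] := idK x kx.
Qed.

(** An element of the minimum ideal is a right zero; were it also an identity,
the semigroup would be trivial. *)
Lemma ker_no_identity s : s \in ker S -> ~~ is_identity S s.
Proof.
rewrite ker_rank => /andP[/setIdP[Cs _] rs]; apply/negP=> /andP[_ /forall_inP id].
have eqs f : f \in S -> f = s.
  move=> Sf; have [Cf _] := setIdP Sf; have /andP[_ /eqP<-] := id f Sf.
  exact: (collapsing_absorb famC).
have [f [g [/eqs-> /eqs->]]] := collapsing_nontriv famC.
by rewrite eqxx.
Qed.

Lemma collapsing_depths d : is_least (fun k => n - m <= k * (n - r)) d ->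
  [/\ depthN' S = d, depthN S = d, depthM S = d & depthM' S = d].
Proof.
move=> [dP dmin]; apply: depths_const rank_le_neq0 _ => A mA.
have [[nzA sAS gA] _] := mA.
apply: depth_eq => [s | s | | s k].
- exact: ker_no_identity.
- by rewrite ker_rank => /andP[/gA].
- case: d dP {dmin} => [|d] dP; first by lia.
  have [s Ps rs] := short_product d (proj1 mA).
  exists s => //; rewrite ker_rank (prod_of_rank_le sAS Ps).
  by apply: leq_trans rs _; lia.
- rewrite ker_rank => /andP[_ rs] Ps; apply: dmin.
  have := long_product (fun a => min_generates_top mA) Ps; lia.
Qed.

End Collapsing.

(** * Factoring through maps of larger rank *)

Lemma full_transP f : reflect (forall x, exists y, f x = Some y) (f \in full_trans n).
Proof.
rewrite inE; apply: (iffP eqP) => [dom x | ftot].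
  have: x \in pdom f by rewrite dom inE.
  by rewrite inE; case: (f x) => // y _; exists y.
by apply/setP=> x; rewrite !inE; have [y ->] := ftot x.
Qed.

Lemma partial_injP f :
  reflect (forall x x' y, f x = Some y -> f x' = Some y -> x = x')
          (f \in partial_inj n).
Proof.
rewrite inE; apply: (iffP forall_inP) => [finj x x' y fx fx' | finj x].
  have /finj/forall_inP/(_ x') : x \in pdom f by rewrite inE fx.
  by rewrite inE fx fx' eqxx /= => /(_ isT)/eqP.
rewrite inE; case fx: (f x) => [y|] // _; apply/forall_inP=> x' _.
by apply/implyP=> /eqP fx'; rewrite (finj x x' y).
Qed.

(** Choose a set [R] of representatives of the kernel classes of [f] and two points
[x0], [z] outside [R], which exist since [#|R| + 2 <= n]. The factor [e] retracts
the domain of [f] onto [R], except that it fixes [x0]; it never takes the value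
[z]. So [h] may be [f] with its value at [z] changed to a point outside the
image of [f], which raises the rank by one. *)
Lemma split_rank f : (prank f).+2 <= n ->
  exists e h, [/\ prank e = (prank f).+1, prank h = (prank f).+1, f = e * h,
    f \in full_trans n -> e \in full_trans n /\ h \in full_trans n &
    f \in partial_inj n -> e \in partial_inj n /\ h \in partial_inj n].
Proof.
move=> rf; pose rep y := odflt y [pick x | f x == Some y].
have repK y : y \in pimage f -> f (rep y) = Some y.
  move=> /pimageP[x fx]; rewrite /rep; case: pickP => [? /eqP//|/(_ x)].
  by rewrite fx eqxx.
have rep_inj : {in pimage f &, injective rep}.
  by move=> y y' /repK fy /repK; move=> fy' eqr; move: fy; rewrite eqr fy' => -[].
have im_f x y : f x = Some y -> y \in pimage f.
  by move=> fx; apply/pimageP; exists x.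
pose R := rep @: pimage f.
have cR : #|R| = prank f by apply: card_in_imset.
have [x0 [z [x0R zR nzx]]] : exists x0 z, [/\ x0 \notin R, z \notin R & x0 != z].
  have /card_gt1P[x0 [z []]] : 1 < #|~: R|.
    by have := cardsC R; rewrite card_ord cR; lia.
  by rewrite !in_setC => *; exists x0, z.
have [y0 y0f] : exists y0, y0 \notin pimage f.
  have /card_gt0P[y] : 0 < #|~: pimage f|.
    by have := cardsC (pimage f); rewrite card_ord -/(prank f); lia.
  by rewrite in_setC; exists y.
have rep_x0 y : y \in pimage f -> rep y != x0.
  by move=> yf; apply: contraNneq x0R => <-; apply: imset_f.
have rep_z y : y \in pimage f -> rep y != z.
  by move=> yf; apply: contraNneq zR => <-; apply: imset_f.
pose e : PT n := [ffun x => if x == x0 then Some x0 else omap rep (f x)].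
pose h : PT n := [ffun x => if x == z then Some y0 else f x].
exists e, h; split.
- suff eE : pimage e = x0 |: R by rewrite /prank eE cardsU1 x0R cR.
  apply/setP=> y; rewrite in_setU1.
  apply/pimageP/predU1P=> [[x]|[->|/imsetP[y' y'f ->]]].
  + rewrite ffunE; case: eqP => [_ [<-]|_]; first by left.
    case fx: (f x) => [y'|] // [<-]; right.
    by apply: imset_f; apply: im_f fx.
  + by exists x0; rewrite ffunE eqxx.
  + by exists (rep y'); rewrite ffunE (negPf (rep_x0 _ y'f)) repK.
- suff hE : pimage h = y0 |: pimage f by rewrite /prank hE cardsU1 y0f.
  apply/setP=> y; rewrite in_setU1.
  apply/pimageP/predU1P=> [[x]|[->|yf]].
  + by rewrite ffunE; case: eqP => [_ [<-]|_ /im_f]; [left|right].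
  + by exists z; rewrite ffunE eqxx.
  + by exists (rep y); rewrite ffunE (negPf (rep_z _ yf)) repK.
- apply/ffunP=> x; rewrite mulPTE ffunE; case: eqP => [->|_] /=.
    by rewrite ffunE (negPf nzx).
  case fx: (f x) => [y|] //=; have yf := im_f _ _ fx.
  by rewrite ffunE (negPf (rep_z _ yf)) repK.
- move=> /full_transP ftot; split; apply/full_transP=> x; rewrite ffunE.
    by case: eqP => _; [exists x0 | have [y ->] := ftot x; exists (rep y)].
  by case: eqP => _; [exists y0 | apply: ftot].
- move=> /partial_injP finj; split; apply/partial_injP=> x x' y; rewrite !ffunE.
    have e_id x1 : (if x1 == x0 then Some x0 else omap rep (f x1)) = Some y ->
        x1 = y.
      case: eqP => [-> [] //|_]; case fx1: (f x1) => [y1|] // [<-].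
      by apply: (finj _ _ y1) => //; apply/repK/im_f/fx1.
    by move=> /e_id-> /e_id->.
  case: eqP => [-> [<-]|_ fx]; case: eqP => [-> //|_ fx'].
  + by rewrite (im_f _ _ fx') in y0f.
  + by move=> [y0E]; rewrite y0E (im_f _ _ fx) in y0f.
  + exact: finj fx fx'.
Qed.

(** * Collapsing a prescribed set *)

(** [E] will be the set of points whose collapse or removal lowers the rank to
[r]; it should waste as little as possible outside [Y]. Take [E] inside [Y] or containing [Y], according to which of [k] and [#|Y|] is
the smaller. *)
Lemma absorbing_subset Y Z k : k <= #|Z| -> Y \subset Z ->
  exists2 E : {set 'I_n}, E \subset Z /\ #|E| = k & #|Y :\: E| <= #|Y| - k.
Proof.
have sub_of_card W j : j <= #|W| -> exists2 E : {set 'I_n}, E \subset W & #|E| = j.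
  move=> /card_geqP[s [us <- sW]]; exists [set x in s].
    by apply/subsetP=> x; rewrite inE => /sW.
  by rewrite cardsE; apply/card_uniqP.
move=> kZ sYZ; have [lekY|ltYk] := leqP k #|Y|.
  have [E sEY cE] := sub_of_card Y k lekY; exists E.
    by split=> //; apply: subset_trans sYZ.
  by rewrite cardsD (setIidPr sEY) cE.
have [|F sF cF] := sub_of_card (Z :\: Y) (k - #|Y|).
  by rewrite cardsD (setIidPr sYZ); lia.
have sFY : F \subset ~: Y by apply: subset_trans sF _; rewrite setDE subsetIr.
exists (Y :|: F); last by rewrite setDUr setDv set0I cards0.
split; first by rewrite subUset sYZ (subset_trans sF) // subsetDl.
rewrite cardsU cF disjoint_setI0 ?cards0; first by lia.
by rewrite disjoint_sym disjoints_subset.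
Qed.

Lemma full_transM : {in full_trans n &, forall f g, f * g \in full_trans n}.
Proof.
move=> f g /full_transP ftot /full_transP gtot; apply/full_transP=> x.
by rewrite mulPTE; have [y ->] := ftot x; apply: gtot.
Qed.

Lemma partial_injM : {in partial_inj n &, forall f g, f * g \in partial_inj n}.
Proof.
move=> f g /partial_injP finj /partial_injP ginj; apply/partial_injP=> x x' y.
rewrite !mulPTE; case fx: (f x) => [z|] //=; case fx': (f x') => [z'|] //= gz gz'.
by apply: (finj _ _ z fx); rewrite fx' (ginj _ _ _ gz gz').
Qed.

(** The idempotents of the symmetric inverse semigroup. *)
Definition pid Y : PT n := [ffun x => if x \in Y then Some x else None].

Lemma pid_inj Y : pid Y \in partial_inj n.
Proof.
apply/partial_injP=> x x' y; rewrite !ffunE.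
by case: ifP => // _ [->]; case: ifP => // _ [->].
Qed.

Lemma pimg_pid Y Z : pimg (pid Y) Z = Z :&: Y.
Proof.
apply/setP=> y; rewrite in_setI; apply/pimgP/andP=> [[x Zx]|[Zy Yy]].
  by rewrite ffunE; case: ifP => // Yx [<-].
by exists y => //; rewrite ffunE Yy.
Qed.

Lemma prank_pid Y : prank (pid Y) = #|Y|.
Proof. by rewrite /prank -pimg_setT pimg_pid setTI. Qed.

(** Treats partial maps and partial injections together: in both families a set
[Y] is collapsed by a partial identity undefined on [n - r] points, as many
of them in [Y] as possible. *)
Lemma partial_collapsing C r : 0 < r < n -> partial_inj n \subset C ->
    {in C &, forall f g, f * g \in C} ->
    (forall f, f \in C -> (prank f).+2 <= n ->
      exists e h, [/\ e \in C, h \in C, prank e = (prank f).+1,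
                      prank h = (prank f).+1 & f = e * h]) ->
  collapsing C r 0.
Proof.
move=> /andP[r_gt0 ltrn] sC mulC splitC.
have rank0 (c : PT n) : prank c <= 0 -> forall x, c x = None.
  rewrite leqn0 => /eqP/cards0_eq c0 x; case cx: (c x) => [y|] //.
  by have: y \in pimage c; [apply/pimageP; exists x | rewrite c0 inE].
have collapse Y : exists f,
    [/\ f \in C, prank f = r & #|pimg f Y| <= maxn 0 (#|Y| - (n - r))].
  have [||E [_ cE] cYE] := @absorbing_subset Y setT (n - r).
  - by rewrite cardsT card_ord leq_subr.
  - exact: subsetT.
  exists (pid (~: E)); split.
  - exact: subsetP sC _ (pid_inj _).
  - by rewrite prank_pid; have := cardsC E; rewrite card_ord; lia.
  - by rewrite pimg_pid -setDE max0n.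
split=> // [f c _ _ /rank0 c0 | ].
  apply/ffunP=> x; rewrite mulPTE c0.
  by case: (f x) => //= y; rewrite c0.
have [f [Cf rf _]] := collapse set0.
have r0 : prank (pid set0) = 0 by rewrite prank_pid cards0.
exists f, (pid set0); split; first by rewrite inE Cf rf /=.
  by rewrite inE r0 (subsetP sC) ?pid_inj.
by apply/eqP=> E; move: rf; rewrite E r0; lia.
Qed.

Lemma setT_collapsing r : 0 < r < n -> collapsing [set: PT n] r 0.
Proof.
move=> hr; apply: partial_collapsing => // [f g _ _|f _ rf]; first by rewrite in_setT.
have [e [h [re rh fE _ _]]] := split_rank rf.
by exists e, h; rewrite !in_setT.
Qed.

Lemma partial_inj_collapsing r : 0 < r < n -> collapsing (partial_inj n) r 0.
Proof.
move=> hr; apply: partial_collapsing => // [|f Cf rf]; first exact: partial_injM.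
have [e [h [re rh fE _ /(_ Cf)[Ce Ch]]]] := split_rank rf.
by exists e, h.
Qed.

(** To collapse [Y] by a total map of rank [r], choose [c] in [Y], or anywhere if
[Y] is empty, send [n - r] other points to [c] and fix the rest; as many of the moved points as possible are taken
in [Y] minus [c]. *)
Lemma full_trans_collapsing r : 0 < r < n -> collapsing (full_trans n) r 1.
Proof.
move=> /andP[r_gt0 ltrn].
pose cst c : PT n := [ffun=> Some c].
have cst_tot c : cst c \in full_trans n.
  by apply/full_transP=> x; exists c; rewrite ffunE.
have rank_cst c : prank (cst c) <= 1.
  rewrite -(cards1 c); apply/subset_leq_card/subsetP=> y /pimageP[x].
  by rewrite ffunE inE => -[->].
split.
- exact: full_transM.
- move=> f Cf rf; have [e [h [re rh fE /(_ Cf)[Ce Ch] _]]] := split_rank rf.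
  by exists e, h.
- move=> Y; have [c cY] : exists c, Y :\ c = set0 \/ c \in Y.
    have [->|[c Yc]] := set_0Vmem Y; last by exists c; right.
    by exists (Ordinal ltrn); left; rewrite set0D.
  have [||E [sE cE] cYE] := @absorbing_subset (Y :\ c) (~: [set c]) (n - r).
  + by rewrite cardsC1 card_ord; lia.
  + by rewrite setDE subsetIr.
  have cNE : c \notin E by apply/negP=> /(subsetP sE); rewrite !inE eqxx.
  pose f : PT n := [ffun x => Some (if x \in E then c else x)].
  exists f; split.
  + by apply/full_transP=> x; rewrite ffunE; eexists.
  + suff fE : pimage f = ~: E.
      by rewrite /prank fE; have := cardsC E; rewrite card_ord; lia.
    apply/setP=> y; rewrite in_setC; apply/pimageP/idP=> [[x]|nEy].
      by rewrite ffunE => -[<-]; case: ifP => // ->.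
    by exists y; rewrite ffunE (negPf nEy).
  + apply: (@leq_trans #|c |: (Y :\ c) :\: E|).
      apply/subset_leq_card/subsetP=> y /pimgP[x Yx].
      rewrite ffunE => -[<-]; rewrite !inE; case: ifP => [|Ex]; first by rewrite eqxx.
      by rewrite Ex Yx andbT; case: eqP.
    have := leq_b1 (c \notin (Y :\ c) :\: E); rewrite cardsU1.
    move: (nat_of_bool _) => i lei1.
    case: cY => [Y0|Yc]; first by rewrite Y0 set0D cards0; lia.
    by have := cardsD1 c Y; rewrite Yc; move: cYE; lia.
- move=> f c /full_transP ftot /full_transP ctot rc; apply/ffunP=> x.
  rewrite mulPTE; have [y ->] := ftot x; rewrite /=.
  have [[u cy] [v cx]] := (ctot y, ctot x); rewrite cy cx; congr Some.
  by apply: (card_le1_eqP rc); apply/pimageP; [exists x | exists y].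
- have cst_le c : cst c \in rank_le (full_trans n) r.
    by apply/setIdP; split; rewrite ?(leq_trans (rank_cst _)).
  exists (cst (Ordinal ltrn)), (cst (Ordinal (ltn_trans r_gt0 ltrn))).
  split=> //; apply/eqP=> /ffunP/(_ (Ordinal ltrn)); rewrite !ffunE => -[r0].
  by rewrite r0 in r_gt0.
Qed.

End PartialMaps.

(** * Ceilings and the three semigroups *)

Import GRing.Theory Num.Theory Order.TTheory.

Lemma ceil_least (a b d : nat) : 0 < b -> is_least (fun k => a <= k * b) d ->
  Posz d = Num.ceil (a%:R / b%:R : rat)%R.
Proof.
move=> b_gt0 [ad dmin]; apply/eqP; rewrite eq_le.
have ltb : (0 < b%:R :> rat)%R by rewrite ltr0n.
have leE (k : nat) : (Num.ceil (a%:R / b%:R : rat) <= Posz k)%R = (a <= k * b).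
  by rewrite ceil_le_int ler_pdivrMr // -natrM ler_nat.
rewrite leE ad andbT.
have : (0 <= Num.ceil (a%:R / b%:R : rat))%R.
  by rewrite ceil_ge0 (lt_le_trans (ltrN10 _)) // divr_ge0 ?ler0n.
case cE: (Num.ceil _) => [c|c] // _.
by rewrite lez_nat; apply: dmin; rewrite -leE cE.
Qed.

Theorem proposition3p21 (n r : nat) (hn : 1 < n) (hr : 1 <= r <= n.-1) :
  let cK := Num.ceil ((n%:R - 1) / (n%:R - r%:R) : rat)%R in
  let cL := Num.ceil (n%:R / (n%:R - r%:R) : rat)%R in
  [/\ [/\ Posz (depthN' (K n r)) = cK, Posz (depthN (K n r)) = cK,
           Posz (depthM (K n r)) = cK & Posz (depthM' (K n r)) = cK],
      [/\ Posz (depthN' (K' n r)) = cL, Posz (depthN (K' n r)) = cL,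
           Posz (depthM (K' n r)) = cL & Posz (depthM' (K' n r)) = cL]
    & [/\ Posz (depthN' (L n r)) = cL, Posz (depthN (L n r)) = cL,
           Posz (depthM (L n r)) = cL & Posz (depthM' (L n r)) = cL]].
Proof.
have /andP[r_gt0 ltrn] : 0 < r < n by lia.
have hr' : 0 < r < n by rewrite r_gt0.
have least_ex m : exists d, is_least (fun k => n - m <= k * (n - r)) d.
  by exists (least (fun k => n - m <= k * (n - r))); apply: (@leastP _ n); nia.
have subr_gt0 : 0 < n - r by lia.
move=> cK cL.
have [[dK dKP] [dL dLP]] := (least_ex 1, least_ex 0).
have cKE : cK = Posz dK
  by rewrite (ceil_least _ dKP) // !natrB ?(ltnW hn) ?(ltnW ltrn).
have cLE : cL = Posz dL
  by rewrite (ceil_least _ dLP) // subn0 natrB ?(ltnW ltrn).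
have K'E : K' n r = rank_le [set: PT n] r.
  by apply/setP=> f; rewrite !inE.
have n_gt0 : 0 < n by apply: ltnW.
rewrite cKE cLE; split.
- by have [-> -> -> ->] := collapsing_depths (full_trans_collapsing hr') ltrn hn dKP.
- rewrite K'E.
  by have [-> -> -> ->] := collapsing_depths (setT_collapsing hr') ltrn n_gt0 dLP.
- by have [-> -> -> ->] := collapsing_depths (partial_inj_collapsing hr') ltrn n_gt0 dLP.
Qed.
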